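(* Let $0<q<1$, $c,d>0$, $p,l\in\mathbb{Z}_+$ and $x\in\mathbb{C}$. Then $$ \begin{aligned} &(-1)^l q^{-\frac12 l(l+1)}\frac{(-qd/c;q)_l}{(q^{l+1};q)_l}\,P_l(x;1,1,c,d;q)\,\hat P_p(x;0,0,c,d;q)\\ &= \frac{1}{(q;q)_l}\,R_l\,p_l(q^p;1,1;q)\,\hat P_p(x;0,0,c,d;q)\\ &\quad+\sum_{m=1}^l (-1)^m\frac{d^m q^{m(p-l)}(q^p;q^{-1})_m}{(q;q)_{l-m}(q;q)_m}\,R_{l-m}\,p_{l-m}(q^{p-m};q^m,q^m;q)\,\hat P_{p-m}(x;0,0,c,d;q)\\ &\quad+\sum_{m=1}^l (-1)^m\frac{q^{\frac12 m(m+1)-lm}}{c^m(q;q)_{l-m}(q;q)_m}\,R_{l-m}\,p_{l-m}(q^{p};q^m,q^m;q)\,\hat P_{p+m}(x;0,0,c,d;q), \end{aligned} $$ where $R_{j}$ denotes the dual $q$-Krawtchouk value $R_j=R_j(q^{-l}-\tfrac dc q^{-l};\tfrac cd,2l;q)$ defined in the context, and $\hat P_n:=0$ for $n<0$.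
   Context: $(a;q)_n=\prod_{j=0}^{n-1}(1-aq^j)$ and $(q^p;q^{-1})_m=\prod_{j=0}^{m-1}(1-q^{p-j})$ (so terms with $m>p$ in the second sum vanish). Big $q$-Jacobi polynomial: $P_n(x;a,b,c,d;q)=\sum_{k=0}^n\frac{(q^{-n};q)_k(abq^{n+1};q)_k(qax/c;q)_k}{(qa;q)_k(-qad/c;q)_k(q;q)_k}q^k$; $P_n(x;1,1,c,d;q)$ is the big $q$-Legendre polynomial. Little $q$-Jacobi polynomial: $p_n(x;a,b;q)=\sum_{k=0}^n\frac{(q^{-n};q)_k(q^{n+1}ab;q)_k}{(qa;q)_k(q;q)_k}(qx)^k$. Monic polynomials $\hat P_n(x;0,0,c,d;q)$: $\hat P_{-1}=0$, $\hat P_0=1$, $x\hat P_n=\hat P_{n+1}+q^n(c-d)\hat P_n+q^{n-1}cd(1-q^n)\hat P_{n-1}$; equivalently $\hat P_n(x;0,0,c,d;q)=d^n q^{\frac12 n(n-1)}\sum_{k=0}^n \frac{(q^{-n};q)_k (c/x;q)_k}{(q;q)_k}(-qx/d)^k$. Dual $q$-Krawtchouk polynomial: for $0\le n\le N$, $R_n(q^{-y}-s^{-1}q^{y-N};s,N;q)=\sum_{k=0}^n\frac{(q^{-n};q)_k(q^{-y};q)_k(-s^{-1}q^{y-N};q)_k}{(q^{-N};q)_k(0;q)_k(q;q)_k}q^k$ with $(0;q)_k=1$; thus $R_j(q^{-l}-\tfrac dc q^{-l};\tfrac cd,2l;q)=\sum_{k=0}^{j}\frac{(q^{-j};q)_k(q^{-l};q)_k(-\frac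 dc q^{-l};q)_k}{(q^{-2l};q)_k(q;q)_k}q^k$ for $0\le j\le l$. *)

(* Defs.v *)
(* Complex numbers are modelled by an arbitrary
   numClosedFieldType C (e.g. algC, or R[i] for R a realType). *)
From mathcomp Require Import all_boot all_order all_algebra.
Set Implicit Arguments. Unset Strict Implicit. Unset Printing Implicit Defensive.
Import Order.TTheory GRing.Theory Num.Theory.
Local Open Scope ring_scope.

Section Defs.
Variable C : numClosedFieldType.

Definition qpoch (a q : C) (n : nat) : C := \prod_(j < n) (1 - a * q ^+ j).

Definition qpoch_down (q : C) (p m : nat) : C :=
  \prod_(j < m) (1 - q ^ (p%:Z - j%:Z)).

Definition bigqJacobi (n : nat) (x a b c d q : C) : C :=
  \sum_(k < n.+1)
    (qpoch (q ^- n) q k * qpoch (a * b * q ^+ n.+1) q k * qpoch (q * a * x / c) q k)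
    / (qpoch (q * a) q k * qpoch (- q * a * d / c) q k * qpoch q q k) * q ^+ k.

Definition littleqJacobi (n : nat) (x a b q : C) : C :=
  \sum_(k < n.+1)
    (qpoch (q ^- n) q k * qpoch (q ^+ n.+1 * a * b) q k)
    / (qpoch (q * a) q k * qpoch q q k) * (q * x) ^+ k.

(* pairs (Phat_{n-1}, Phat_n) for the monic polynomials Phat_n(x;0,0,c,d;q),
   from the three-term recurrence
   x P_n = P_{n+1} + q^n (c-d) P_n + q^{n-1} c d (1-q^n) P_{n-1},
   P_{-1} = 0, P_0 = 1. *)
Fixpoint Phat_pair (n : nat) (x c d q : C) : C * C :=
  match n with
  | 0 => (0, 1)
  | n'.+1 =>
      let: (a, b) := Phat_pair n' x c d q in
      (b, (x - q ^+ n' * (c - d)) * b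
            - q ^ (n'%:Z - 1) * c * d * (1 - q ^+ n') * a)
  end.

Definition Phat (n : int) (x c d q : C) : C :=
  match n with
  | Posz k => (Phat_pair k x c d q).2
  | Negz _ => 0
  end.

(* dual q-Krawtchouk R_n(q^{-y} - s^{-1} q^{y-N}; s, N; q) *)
Definition dualqKrawtchouk (n y : nat) (s : C) (N : nat) (q : C) : C :=
  \sum_(k < n.+1)
    (qpoch (q ^- n) q k * qpoch (q ^- y) q k
       * qpoch (- s^-1 * q ^ (y%:Z - N%:Z)) q k)
    / (qpoch (q ^- N) q k * qpoch q q k) * q ^+ k.

End Defs.

(* Main.v *)
(* By its three-term recurrence, multiplication by x acts on the sequence
   Phat_p(x;0,0,c,d;q) as a tridiagonal matrix X.  The coefficients on the
   right-hand side form a banded matrix which, after rescaling by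
   gamma_prod, is symmetric, and it commutes with X: this amounts to the forward
   and backward shift relations of the little q-Jacobi polynomials together with
   the recurrence of the dual q-Krawtchouk polynomials.  Hence the
   right-hand side at p is Phat_p(x) times the right-hand side at p = 0.
   The case p = 0 is the expansion of a big q-Legendre polynomial in the
   Phat_m; it is proved for P_n(x;q^s,q^s,c,d;q), with n + s fixed, by induction
   on n: the q-derivative lowers n and raises s, and the constant of integration
   is fixed at x = c with the q-binomial and q-Vandermonde sums. *)
Require Import Defs.
From mathcomp Require Import all_boot all_order all_algebra.
From mathcomp Require Import ring zify.
Import Order.TTheory GRing.Theory Num.Theory.
Local Open Scope ring_scope.

Section QSeries.
Variables (C : numClosedFieldType) (q : C).
Hypotheses (q_gt0 : 0 < q) (q_lt1 : q < 1).

Let q_neq0 : q != 0. Proof. by rewrite gt_eqF. Qed.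

Let qX_neq0 n : q ^+ n != 0. Proof. by rewrite expf_neq0. Qed.

Lemma onesubX_neq0 n : 1 - q ^+ n.+1 != 0.
Proof. by rewrite subr_eq0 eq_sym lt_eqF // exprn_ilt1 // ltW. Qed.

(** * Terminating basic hypergeometric sums *)

Lemma qpoch0 a : qpoch a q 0 = 1.
Proof. by rewrite /qpoch big_ord0. Qed.

Lemma qpochS a n : qpoch a q n.+1 = qpoch a q n * (1 - a * q ^+ n).
Proof. by rewrite /qpoch big_ord_recr. Qed.

Lemma qpochSl a n : qpoch a q n.+1 = (1 - a) * qpoch (a * q) q n.
Proof.
rewrite /qpoch big_ord_recl expr0 mulr1; congr (_ * _).
by apply: eq_bigr => i _; rewrite /= /bump /= exprS mulrA.
Qed.

Lemma qpoch_neq0 a n :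
  (forall k, (k < n)%N -> 1 - a * q ^+ k != 0) -> qpoch a q n != 0.
Proof. by move=> h; apply/prodf_neq0 => i _; apply: h. Qed.

Lemma qfact_neq0 n : qpoch q q n != 0.
Proof. by apply: qpoch_neq0 => k _; rewrite -exprS onesubX_neq0. Qed.

Lemma qpoch_qX_neq0 m n : qpoch (q ^+ m.+1) q n != 0.
Proof. by apply: qpoch_neq0 => k _; rewrite -exprD addSn onesubX_neq0. Qed.

Lemma onesubV_neq0 l k : (k < l)%N -> 1 - q ^- l * q ^+ k != 0.
Proof.
move=> kl; have -> : l = (k + (l - k.+1).+1)%N by lia.
rewrite exprD; set m := (_ - _)%N.
have -> : 1 - (q ^+ k * q ^+ m.+1)^-1 * q ^+ k = - (q ^+ m.+1)^-1 * (1 - q ^+ m.+1).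
  by field; rewrite !qX_neq0.
by rewrite mulf_neq0 ?onesubX_neq0 // oppr_eq0 invr_eq0.
Qed.

Lemma qpochV_neq0 l n : (n <= l)%N -> qpoch (q ^- l) q n != 0.
Proof. by move=> nl; apply: qpoch_neq0 => k kn; rewrite onesubV_neq0 //; lia. Qed.

(* The k-th weight of a terminating basic hypergeometric sum of order n; it
   vanishes for k > n. *)
Definition qw n k := qpoch (q ^- n) q k / qpoch q q k * q ^+ k.

Lemma qw0 n : qw n 0 = 1.
Proof. by rewrite /qw !qpoch0 divr1 mul1r. Qed.

Lemma qw_small n k : (n < k)%N -> qw n k = 0.
Proof.
move=> nk; rewrite /qw /qpoch (bigD1 (Ordinal nk)) //=.
by rewrite mulVf ?qX_neq0 // subrr !mul0r.
Qed.

Lemma qw_next n k :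
  qw n k.+1 * (1 - q ^+ k.+1) = q * qw n k * (1 - q ^- n * q ^+ k).
Proof.
rewrite /qw !qpochS -exprS [q ^+ k.+1]exprS; field.
by rewrite -exprS qX_neq0 qfact_neq0 onesubX_neq0.
Qed.

Lemma qw_shift n k :
  qw n.+1 k.+1 * (1 - q ^+ k.+1) = q * (1 - q ^- n.+1) * qw n k.
Proof.
rewrite /qw qpochSl qpochS -!exprS.
have -> : q ^- n.+1 * q = q ^- n by rewrite exprS; field; rewrite qX_neq0 q_neq0.
rewrite [q ^+ k.+1]exprS; field.
by rewrite -exprS qfact_neq0 onesubX_neq0 qX_neq0.
Qed.

Lemma qw_pred n k :
  qw n k * (1 - q ^- n.+1) = qw n.+1 k * (1 - q ^- n.+1 * q ^+ k).
Proof.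
have := qpochS (q ^- n.+1) k; rewrite qpochSl.
have -> : q ^- n.+1 * q = q ^- n by rewrite exprS; field; rewrite qX_neq0 q_neq0.
move=> e; rewrite /qw.
transitivity ((1 - q ^- n.+1) * qpoch (q ^- n) q k * (q ^+ k / qpoch q q k)).
  by ring.
by rewrite e; ring.
Qed.

(** A q-Pascal rule: after multiplication by the nonzero factor [1 - q ^+ k.+1], [qw_shift] and
    [qw_next] turn every term into a multiple of [qw n k]. *)
Lemma qwSS n k : qw n.+1 k.+1 = qw n k.+1 - q ^- n * qw n k.
Proof.
apply: (mulIf (onesubX_neq0 k)).
rewrite qw_shift mulrBl qw_next [q ^+ k.+1]exprS [q ^+ n.+1]exprS.
by field; rewrite qX_neq0 q_neq0.
Qed.

(** Summation by parts through [qwSS]. It lowers the order of a terminating sum at the cost of a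
    twisted difference of [f], and drives the inductions on the order below. *)
Lemma qw_sumS n (f : nat -> C) :
  \sum_(k < n.+2) qw n.+1 k * f k
  = \sum_(k < n.+1) qw n k * (f k - q ^- n * f k.+1).
Proof.
rewrite big_ord_recl qw0 /=.
under eq_bigr => k _ do rewrite /= /bump /= add1n qwSS mulrBl.
rewrite sumrB addrA.
have -> : 1 * f 0 + \sum_(k < n.+1) qw n k.+1 * f k.+1 = \sum_(k < n.+1) qw n k * f k.
  rewrite big_ord_recr /= qw_small // mul0r addr0 [RHS]big_ord_recl qw0.
  by [].
by rewrite -sumrB; apply: eq_bigr => k _; ring.
Qed.

Lemma qw_geom n y : \sum_(k < n.+1) qw n k * y ^+ k = \prod_(i < n) (1 - q ^- i * y).
Proof.
elim: n => [|n IH]; first by rewrite big_ord1 big_ord0 qw0 mulr1.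
rewrite qw_sumS [in RHS]big_ord_recr /= -IH mulr_suml.
by apply: eq_bigr => k _; rewrite exprS; ring.
Qed.

(** The q-Chu-Vandermonde sum. [qw_sumS] produces one sum with [(b, e)] and one with
    [(b * q, e * q)], so the induction generalises over both; the quotient [e / b] is the same in
    the two. *)
Lemma q_vandermonde n (b e : C) : b != 0 -> qpoch e q n != 0 ->
  \sum_(k < n.+1) qw n k * (qpoch b q k / qpoch e q k)
  = qpoch (e / b) q n / qpoch e q n * b ^+ n.
Proof.
move=> b0; elim: n b e b0 => [|n IH] b e b0 he.
  by rewrite big_ord1 qw0 !qpoch0; field.
have := he; rewrite qpochS mulf_eq0 negb_or => /andP[he1 hen].
have := he; rewrite qpochSl mulf_eq0 negb_or => /andP[he0 heS].
rewrite (qw_sumS n (fun k => qpoch b q k / qpoch e q k)).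
under eq_bigr => k _ do rewrite mulrBr.
rewrite sumrB IH //.
have -> : \sum_(k < n.+1) qw n k * (q ^- n * (qpoch b q k.+1 / qpoch e q k.+1))
   = q ^- n * ((1 - b) / (1 - e)) *
     \sum_(k < n.+1) qw n k * (qpoch (b * q) q k / qpoch (e * q) q k).
  rewrite mulr_sumr; apply: eq_bigr => k _; rewrite !qpochSl invfM; ring.
rewrite IH ?mulf_neq0 //.
have -> : e * q / (b * q) = e / b by field; rewrite q_neq0 b0.
rewrite !qpochS.
have e2 : qpoch (e * q) q n = qpoch e q n * (1 - e * q ^+ n) / (1 - e).
  by rewrite -qpochS qpochSl; field.
rewrite e2 exprMn exprS; field.
by rewrite he1 hen he0 qX_neq0 b0.
Qed.


Lemma qw_sum_widen n K (f : nat -> C) : (n < K)%N ->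
  \sum_(k < K) qw n k * f k = \sum_(k < n.+1) qw n k * f k.
Proof.
move=> nK; rewrite -(subnKC nK) big_split_ord /= [X in _ + X]big1 ?addr0 //.
by move=> i _; rewrite qw_small ?mul0r // leq_addr.
Qed.

(** * Little q-Jacobi and dual q-Krawtchouk polynomials *)

Lemma littleqJacobiE n m z :
  littleqJacobi n z (q ^+ m) (q ^+ m) q
  = \sum_(k < n.+1) qw n k * (qpoch (q ^+ (n + m + m).+1) q k
                              / qpoch (q ^+ m.+1) q k * z ^+ k).
Proof.
apply: eq_bigr => k _; rewrite /qw -!exprD -exprS !addSn exprMn invfM; ring.
Qed.

(** In the difference the power [z ^+ k.+1] gains the factor [1 - q ^+ k.+1], which [qw_shift]
    absorbs into the weight, and the constant term cancels. *)
Lemma littleqJacobi_forward n m z :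
  littleqJacobi n.+1 z (q ^+ m) (q ^+ m) q
  - littleqJacobi n.+1 (q * z) (q ^+ m) (q ^+ m) q
  = q * z * (1 - q ^- n.+1) * (1 - q ^+ (n + m + m).+2) / (1 - q ^+ m.+1)
    * littleqJacobi n z (q ^+ m.+1) (q ^+ m.+1) q.
Proof.
rewrite !littleqJacobiE -sumrB mulr_sumr big_ord_recl /= !expr0 subrr add0r.
apply: eq_bigr => k _; rewrite /= /bump /= add1n !qpochSl.
have -> : q ^+ (n + m.+1 + m.+1).+1 = q ^+ (n.+1 + m + m).+1 * q.
  by rewrite -exprSr; congr (_ ^+ _); lia.
rewrite -!exprSr !addSn.
transitivity (qw n.+1 k.+1 * (1 - q ^+ k.+1) *
  ((1 - q ^+ (n + m + m).+2) / (1 - q ^+ m.+1) *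
  (qpoch (q ^+ (n + m + m).+3) q k / qpoch (q ^+ m.+2) q k)) * z ^+ k.+1).
  by rewrite exprMn invfM; ring.
by rewrite qw_shift [z ^+ _]exprS; ring.
Qed.

(** Comparison of the coefficients of each power of [z]; [qw_next] and [qw_shift] reduce both sides
    to multiples of [qw n k]. *)
Lemma littleqJacobi_backward n m z :
  (1 - z) * littleqJacobi n (z / q) (q ^+ m.+1) (q ^+ m.+1) q
  - q ^+ m.+1 * (1 - z * q ^+ m.+1) * littleqJacobi n z (q ^+ m.+1) (q ^+ m.+1) q
  = (1 - q ^+ m.+1) * littleqJacobi n.+1 z (q ^+ m) (q ^+ m) q.
Proof.
rewrite !littleqJacobiE.
set g := fun k => qpoch (q ^+ (n + m.+1 + m.+1).+1) q k / qpoch (q ^+ m.+2) q k.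
(* Regrouped by powers of [z]. The first sum gets an extra zero term so that its tail aligns with
   the second sum. *)
have -> : (1 - z) * \sum_(k < n.+1) qw n k * (g k * (z / q) ^+ k)
    - q ^+ m.+1 * (1 - z * q ^+ m.+1) * \sum_(k < n.+1) qw n k * (g k * z ^+ k)
  = \sum_(k < n.+2) qw n k * (g k * (q ^- k - q ^+ m.+1) * z ^+ k)
    - \sum_(k < n.+1) qw n k * (g k * (q ^- k - q ^+ m.+1 * q ^+ m.+1) * z ^+ k.+1).
  rewrite (qw_sum_widen _ _ (fun k => g k * (q ^- k - q ^+ m.+1) * z ^+ k)) //.
  rewrite !mulr_sumr -!sumrB; apply: eq_bigr => k _.
  by rewrite exprMn exprVn [z ^+ k.+1]exprS; ring.
rewrite big_ord_recl -addrA -sumrB [in RHS]big_ord_recl [RHS]mulrDr mulr_sumr.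
congr (_ + _); first by rewrite /= /g !qpoch0 !qw0 expr0; field.
apply: eq_bigr => k _; rewrite /= /bump /= add1n.
apply: (mulIf (onesubX_neq0 k)).
transitivity ((qw n k.+1 * (1 - q ^+ k.+1) * (g k.+1 * (q ^- k.+1 - q ^+ m.+1))
   - (1 - q ^+ k.+1) * qw n k * (g k * (q ^- k - q ^+ m.+1 * q ^+ m.+1))) * z ^+ k.+1).
  by ring.
transitivity (qw n.+1 k.+1 * (1 - q ^+ k.+1) * ((1 - q ^+ m.+1) *
   (qpoch (q ^+ (n.+1 + m + m).+1) q k.+1 / qpoch (q ^+ m.+1) q k.+1)) * z ^+ k.+1);
  last by ring.
congr (_ * _); rewrite qw_shift qw_next /g qpochS [qpoch (q ^+ m.+2) q k.+1]qpochS.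
rewrite [qpoch (q ^+ (n.+1 + _ + _).+1) _ _]qpochSl [qpoch (q ^+ m.+1) _ _]qpochSl.
have -> : (n + m.+1 + m.+1).+1 = (n + m + m).+3 by lia.
rewrite -!exprSr !addSn.
have h1 := qpoch_qX_neq0 m.+1 k.
have h2 := onesubX_neq0 (m.+1 + k); have h3 := onesubX_neq0 m.
rewrite -addSn exprD in h2.
move: h1 h2 h3; set P := qpoch _ _ _; set D := qpoch _ _ _; set W := qw _ _.
move: P D W => P D W; rewrite !exprS !exprD => h1 h2 h3; field.
by rewrite h1 h2 h3 !qX_neq0 q_neq0.
Qed.

(* The dual q-Krawtchouk value R_n of the theorem for a = - d / c. *)
Definition krawt l a n := \sum_(k < n.+1)
  qw n k * (qpoch (q ^- l) q k * qpoch (a * q ^- l) q k / qpoch (q ^- (l + l)) q k).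

(** The recurrence in the degree. Writing [l] as [(n + s).+1] keeps the degree [n.+1] at most [l],
    so that no denominator vanishes; at [n = 0] the factor [q ^- n - 1] removes the spurious
    [krawt l a n.-1]. *)
Lemma krawt_rec n s a (l := (n + s).+1) :
  (1 - q ^+ (l + s.+1)) * krawt l a n.+1
  = (1 - q ^+ s.+1) * (1 + a) * krawt l a n + a * (q ^- n - 1) * krawt l a n.-1.
Proof.
set f := fun k => qpoch (q ^- l) q k * qpoch (a * q ^- l) q k / qpoch (q ^- (l + l)) q k.
have fS k : (k <= n)%N ->
    (1 - q ^- (l + l) * q ^+ k) * f k.+1
    = (1 - q ^- l * q ^+ k) * (1 - a * q ^- l * q ^+ k) * f k.
  move=> kn; rewrite /f !qpochS.
  have h1 : 1 - q ^- (l + l) * q ^+ k != 0 by apply: onesubV_neq0; lia.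
  have h2 : qpoch (q ^- (l + l)) q k != 0 by apply: qpochV_neq0; lia.
  move: h1 h2; set U := 1 - q ^- (l + l) * q ^+ k.
  set D := qpoch (q ^- (l + l)) q k; move: U D => U D h1 h2.
  by field; rewrite h2 h1 qX_neq0.
(* Creative telescoping with certificate c: t k * f k is a difference in k. *)
pose c k := qw n k * (q ^+ (l + l) / q ^+ n / q ^+ k).
pose t k := (1 - q ^+ (l + s.+1)) * qw n.+1 k - (1 - q ^+ s.+1) * (1 + a) * qw n k
            - a * ((q ^- n - 1) * qw n.-1 k).
have wpred k : (q ^- n - 1) * qw n.-1 k = qw n k * (q ^- n * q ^+ k - 1).
  case: (n) => [|n'] /=; last first.
    by rewrite -[LHS]opprK -mulNr opprB mulrC qw_pred; ring.
  case: k => [|k]; first by rewrite expr0 !mulr1 qw0; field.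
  by rewrite qw_small // mul0r invr1 subrr mul0r.
have t0 : t 0 = - (c 0 * (1 - q ^- l) * (1 - a * q ^- l)).
  rewrite /t /c wpred !qw0 !exprD !exprS !exprD; field.
  by rewrite !qX_neq0 q_neq0.
have tS k : t k.+1 = c k * (1 - q ^- (l + l) * q ^+ k)
     - c k.+1 * (1 - q ^- l * q ^+ k.+1) * (1 - a * q ^- l * q ^+ k.+1).
  apply: (mulIf (onesubX_neq0 k)).
  rewrite /t /c wpred qwSS.
  transitivity (((1 - q ^+ (l + s.+1)) - (1 - q ^+ s.+1) * (1 + a)
      - a * (q ^- n * q ^+ k.+1 - 1)) * (qw n k.+1 * (1 - q ^+ k.+1))
     - (1 - q ^+ (l + s.+1)) * (q ^- n * qw n k * (1 - q ^+ k.+1))); first by ring.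
  transitivity (c k * (1 - q ^- (l + l) * q ^+ k) * (1 - q ^+ k.+1)
    - (q ^+ (l + l) / q ^+ n / q ^+ k.+1) * (1 - q ^- l * q ^+ k.+1)
      * (1 - a * q ^- l * q ^+ k.+1) * (qw n k.+1 * (1 - q ^+ k.+1)));
    last by rewrite /c; ring.
  rewrite qw_next /c /l !exprD !exprS !exprD; field.
  by rewrite !qX_neq0 q_neq0.
(* By [fS], the first product in [tS], times [f k.+1], is the boundary term left at [k]. *)
have tele K : (K <= n.+1)%N -> \sum_(k < K.+1) t k * f k
    = - (c K * (1 - q ^- l * q ^+ K) * (1 - a * q ^- l * q ^+ K) * f K).
  elim: K => [_|K IH Kn].
    by rewrite big_ord1 t0 expr0 !mulr1 !mulNr.
  rewrite big_ord_recr /= IH 1?ltnW // tS -!(mulrA (c K)) -fS //.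
  by ring.
(* The last boundary term carries [qw n n.+1], which is zero. *)
have := tele n.+1 (leqnn _); rewrite {1}/c qw_small // !mul0r oppr0.
rewrite /krawt -(qw_sum_widen n n.+2 f) // -(qw_sum_widen n.-1 n.+2 f) ?ltnS; last by lia.
move=> e; apply/eqP; rewrite -subr_eq0; apply/eqP; rewrite -[RHS]e.
rewrite !mulr_sumr opprD addrA -!sumrB; apply: eq_bigr => k _; rewrite /t /f; ring.
Qed.

(** * The q-binomial theorem and a closed sum of dual q-Krawtchouk values *)

Lemma qpoch_add a m n : qpoch a q (m + n) = qpoch a q m * qpoch (a * q ^+ m) q n.
Proof.
rewrite /qpoch big_split_ord; congr (_ * _).
by apply: eq_bigr => i _; rewrite /= exprD mulrA.
Qed.

(** The factor [q ^+ N / q] makes the product in [qw_geom], read backwards, run over nonnegative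
    powers of [q]. *)
Lemma qbinomial N u :
  \sum_(m < N.+1) qw N m * (u * q ^+ N / q) ^+ m = qpoch u q N.
Proof.
rewrite qw_geom /qpoch (reindex_inj rev_ord_inj) /=; apply: eq_bigr => i _.
have e : N = (i + (N - i.+1) + 1)%N by have := ltn_ord i; lia.
rewrite [in X in u * X]e !exprD expr1; field.
by rewrite q_neq0 !qX_neq0.
Qed.

Lemma qw_closed j k :
  qw (j + k) k
  = (-1) ^+ k * q ^+ 'C(k, 2) * q ^+ k * qpoch q q (j + k)
    / ((q ^+ (j + k)) ^+ k * qpoch q q k * qpoch q q j).
Proof.
elim: k => [|k IH].
  by rewrite qw0 addn0 !expr0 qpoch0; field; rewrite qfact_neq0.
apply: (mulIf (onesubX_neq0 k)); rewrite addnS qw_shift IH !qpochS -!exprS binS bin1.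
set N := (j + k)%N.
have -> : (q ^+ N.+1) ^+ k.+1 = (q ^+ N) ^+ k * q ^+ k * q ^+ N.+1.
  by rewrite exprSr exprS exprMn [_ ^+ k * _]mulrC.
have := onesubX_neq0 k; have := qfact_neq0 k; have := qfact_neq0 j.
rewrite exprD !exprS; set P := qpoch q q k; set Q := qpoch q q j.
set Y := (q ^+ N) ^+ k; have : Y != 0 by rewrite expf_neq0.
move: P Q Y => P Q Y hY hQ hP hk; field.
by rewrite q_neq0 !qX_neq0 hY hQ hP hk.
Qed.

(** This is the expansion of a big q-Jacobi polynomial evaluated at [x = c]. After exchanging the
    sums, the inner one is a q-binomial sum and the outer one a q-Vandermonde sum. *)
Lemma krawt_sum_closed l a n : (n <= l)%N ->
  \sum_(m < n.+1) krawt l a (n - m) * (- a) ^+ m * q ^+ 'C(m, 2)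
      / ((q ^+ l) ^+ m * qpoch q q (n - m) * qpoch q q m)
  = qpoch (q ^- l) q n * qpoch (a * q ^- l) q n
    / ((q ^+ l) ^+ n * qpoch q q n * qpoch (q ^- (l + l)) q n).
Proof.
move=> nl.
pose f k := qpoch (q ^- l) q k * qpoch (a * q ^- l) q k / qpoch (q ^- (l + l)) q k.
pose g m := (- a) ^+ m * q ^+ 'C(m, 2) / ((q ^+ l) ^+ m * qpoch q q m).
transitivity (\sum_(m < n.+1) \sum_(k < n.+1)
    f k * (qw (n - m) k / qpoch q q (n - m) * g m)).
  apply: eq_bigr => m _.
  rewrite /krawt -(qw_sum_widen (n - m) n.+1 f) ?ltnS ?leq_subr // !mulr_suml.
  apply: eq_bigr => k _; rewrite /g !invfM; ring.
(* Only [m <= n - k] contributes, since [qw (n - m) k] vanishes beyond; what remains is [qbinomial]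
   of order [n - k]. *)
have inner k : (k <= n)%N ->
    \sum_(m < n.+1) qw (n - m) k / qpoch q q (n - m) * g m
    = qw n k / qpoch q q n * qpoch (a * q ^- l * q ^+ k) q (n - k).
  move=> kn; have [N ->] : exists N, n = (N + k)%N by exists (n - k)%N; lia.
  rewrite addnK -(qbinomial N) mulr_sumr -addSn big_split_ord /= addrC big1 ?add0r.
    apply: eq_bigr => m _; move: (ltn_ord m); rewrite ltnS; move: (m : nat) => {}m mN.
    have [M ->] : exists M, N = (M + m)%N by exists (N - m)%N; lia.
    have -> : (M + m + k - m = M + k)%N by lia.
    rewrite !qw_closed /g [(- a) ^+ m]exprNn !exprMn.
    have -> : (q ^+ (M + m + k)) ^+ k = (q ^+ (M + k)) ^+ k * (q ^+ k) ^+ m.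
      by rewrite addnAC exprD exprMn [(q ^+ k) ^+ m]exprAC.
    have := qfact_neq0 (M + k); have := qfact_neq0 (M + m + k).
    have := qfact_neq0 (M + m); have := qfact_neq0 M; have := qfact_neq0 k.
    have := qfact_neq0 m => h1 h2 h3 h4 h5 h6.
    rewrite !exprVn; field.
    by rewrite h1 h2 h3 h4 h5 h6 !expf_neq0.
  move=> i _; rewrite qw_small ?mul0r //; have := ltn_ord i; lia.
rewrite exchange_big /=.
(* The factor of [f k] in [a] and the value of the inner sum join into [qpoch (a * q ^- l) q n],
   which is independent of [k]. *)
transitivity (qpoch (a * q ^- l) q n / qpoch q q n
   * \sum_(k < n.+1) qw n k * (qpoch (q ^- l) q k / qpoch (q ^- (l + l)) q k)).
  rewrite mulr_sumr; apply: eq_bigr => k _; have kn : (k <= n)%N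
    by have := ltn_ord k; lia.
  have := qpoch_add (a * q ^- l) k (n - k); rewrite subnKC // => ->.
  by rewrite -mulr_sumr inner // /f; ring.
have h : qpoch (q ^- (l + l)) q n != 0 by apply: qpochV_neq0; lia.
rewrite q_vandermonde ?invr_eq0 //.
have -> : q ^- (l + l) / q ^- l = q ^- l by rewrite exprD; field; rewrite qX_neq0.
by rewrite exprVn !invfM; ring.
Qed.

(** * The case p = 0 *)

Variables (c d : C).
Hypotheses (c_gt0 : 0 < c) (d_gt0 : 0 < d).

Let a := - (d / c).

Let c_neq0 : c != 0. Proof. by rewrite gt_eqF. Qed.

Let onesub_aX_neq0 n : 1 - a * q ^+ n != 0.
Proof. by rewrite /a mulNr opprK gt_eqF // addr_gt0 ?mulr_gt0 ?invr_gt0 ?exprn_gt0. Qed.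

Let P n x := Phat (Posz n) x c d q.

(** At [n = 0] the value [P n.-1] is [P 0] rather than zero, but the factor [1 - q ^+ n] cancels
    it. *)
Lemma PhatS n x :
  P n.+1 x = (x - q ^+ n * (c - d)) * P n x - q ^+ n / q * c * d * (1
    - q ^+ n) * P n.-1 x.
Proof.
rewrite /P /=; case: n => [|n] /=; first by rewrite expr0 subrr !mulr0 !mul0r.
case: (Phat_pair n x c d q) => u v /=.
by rewrite [q ^ (n.+1%:Z - 1)]expfzDr.
Qed.

(** The polynomials are rescaled Al-Salam-Carlitz polynomials, whose q-derivative lowers the degree.
    The recurrence has order two, hence the induction on two consecutive cases. *)
Lemma Phat_qdiff n x : P n x - P n (q * x) = (1 - q ^+ n) * x * P n.-1 x.
Proof.
have [] : (P n x - P n (q * x) = (1 - q ^+ n) * x * P n.-1 x) /\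
  (P n.+1 x - P n.+1 (q * x) = (1 - q ^+ n.+1) * x * P n x); last by [].
elim: n => [|n [IH1 IH2]].
  split; first by rewrite /P /= !subrr !mul0r.
  by rewrite !PhatS /= /P /= !expr0 expr1; ring.
split=> //.
have -> : P n.+2 x - P n.+2 (q * x)
  = (q * x - q ^+ n.+1 * (c - d)) * (P n.+1 x - P n.+1 (q * x))
    + (1 - q) * x * P n.+1 x
    - q ^+ n * c * d * (1 - q ^+ n.+1) * (P n x - P n (q * x)).
  by rewrite (PhatS n.+1 x) (PhatS n.+1 (q * x)) /= !exprS; field.
by rewrite IH2 IH1 (PhatS n) !exprS; field.
Qed.

(** In the explicit formula the factor $(c/x;q)_k$ leaves only $k=0$ at $x=c$, which makes [c] a
    convenient point for fixing the constant of integration. *)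
Lemma Phat_at_c n : P n c = d ^+ n * q ^+ 'C(n, 2).
Proof.
have [] : P n c = d ^+ n * q ^+ 'C(n, 2) /\ P n.+1 c = d ^+ n.+1 * q ^+ 'C(n.+1, 2);
  last by [].
elim: n => [|n [IH1 IH2]].
  by rewrite PhatS /P /= !expr0; split; ring.
split=> //; rewrite PhatS IH2 IH1 !binS !bin1 bin0 addn1 !exprD !exprS.
by field.
Qed.

(** * Polynomial functions determined by their q-derivative and one value *)

Definition polyfun (f : C -> C) := exists p : {poly C}, forall x, f x = p.[x].

Lemma polyfunC k : polyfun (fun=> k).
Proof. by exists k%:P => x; rewrite hornerC. Qed.

Lemma polyfunM f g : polyfun f -> polyfun g -> polyfun (fun x => f x * g x).
Proof. by move=> [u hu] [v hv]; exists (u * v) => x; rewrite hornerM hu hv. Qed.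

Lemma polyfun_sum n (F : nat -> C -> C) :
  (forall i, polyfun (F i)) -> polyfun (fun x => \sum_(i < n) F i x).
Proof.
move=> hF; elim: n => [|n [u hu]].
  by exists 0 => x; rewrite big_ord0 horner0.
by have [v hv] := hF n; exists (u + v) => x; rewrite big_ord_recr /= hu hv hornerD.
Qed.

Lemma polyfun_qpoch b n : polyfun (fun x => qpoch (b * x) q n).
Proof.
exists (\prod_(j < n) (1 - (b * q ^+ j)%:P * 'X)) => x.
rewrite horner_prod; apply: eq_bigr => j _.
by rewrite !hornerE; ring.
Qed.

Lemma polyfun_Phat n : polyfun (P n).
Proof.
have [] : polyfun (P n) /\ polyfun (P n.+1); last by [].
elim: n => [|n [[u hu] [v hv]]].
  split; first exact: polyfunC.
  exists ('X - (c - d)%:P) => x; rewrite PhatS /P /= !hornerE; ring.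
split; first by exists v.
exists (('X - (q ^+ n.+1 * (c - d))%:P) * v
        - (q ^+ n.+1 / q * c * d * (1 - q ^+ n.+1))%:P * u) => x.
by rewrite PhatS hu hv !hornerE.
Qed.

(* The difference of f and g vanishes at every point [q ^+ k * x0]. *)
Lemma polyfun_qdiff_inj f g x0 : x0 != 0 -> polyfun f -> polyfun g ->
  (forall x, f x - f (q * x) = g x - g (q * x)) -> f x0 = g x0 -> f =1 g.
Proof.
move=> x00 [u hu] [v hv] fg fg0 x.
suff uv : u - v = 0 by apply/eqP; rewrite -subr_eq0 hu hv -hornerN -hornerD uv horner0.
have root_uv k : root (u - v) (q ^+ k * x0).
  rewrite /root hornerD hornerN -hu -hv subr_eq0; elim: k => [|k /eqP IH].
    by rewrite expr0 mul1r fg0.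
  have := fg (q ^+ k * x0); rewrite IH exprS mulrA => /addrI /oppr_inj ->.
  by [].
apply/eqP/negPn/negP => uv.
have inj : injective (fun k => q ^+ k * x0).
  move=> i j /(mulIf x00); apply: ieexprIn => //.
  by rewrite lt_eqF.
have := @max_poly_roots _ _ [seq q ^+ k * x0 | k <- iota 0 (size (u - v))] uv.
rewrite map_inj_uniq // iota_uniq size_map size_iota ltnn => /(_ _ isT) h.
by suff : false by []; apply: h; apply/allP => y /mapP[k _ ->].
Qed.

(** * Expansion of big q-Jacobi polynomials in the polynomials [P m] *)

Let J n s x := bigqJacobi n x (q ^+ s) (q ^+ s) c d q.

Lemma bigqJacobiE n s x : J n s x = \sum_(k < n.+1) qw n k *
  (qpoch (q ^+ (n + s + s).+1) q k * qpoch (q ^+ s.+1 / c * x) q k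
   / (qpoch (q ^+ s.+1) q k * qpoch (a * q ^+ s.+1) q k)).
Proof.
apply: eq_bigr => k _; rewrite /qw.
have -> : q * q ^+ s * x / c = q ^+ s.+1 / c * x by rewrite exprS; ring.
have -> : - q * q ^+ s * d / c = a * q ^+ s.+1 by rewrite /a exprS; ring.
have -> : q ^+ s * q ^+ s * q ^+ n.+1 = q ^+ (n + s + s).+1.
  by rewrite -!exprD; congr (_ ^+ _); lia.
by rewrite -exprS !invfM; ring.
Qed.

(** The shifted factorials in [x] and [q * x] share all but one factor, and their difference
    contains [1 - q ^+ k.+1], which [qw_shift] absorbs. *)
Lemma bigqJacobi_qdiff n s x :
  J n.+1 s x - J n.+1 s (q * x)
  = - (q ^+ s.+2 / c) * x * (1 - q ^- n.+1) * (1 - q ^+ (n + s + s).+2)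
    / ((1 - q ^+ s.+1) * (1 - a * q ^+ s.+1)) * J n s.+1 x.
Proof.
rewrite !bigqJacobiE -sumrB big_ord_recl !qpoch0 subrr add0r mulr_sumr.
apply: eq_bigr => k _; rewrite /= /bump /= add1n.
set b := q ^+ s.+1 / c.
have -> : (n + s.+1 + s.+1).+1 = (n + s + s).+3 by lia.
rewrite !addSn.
have -> : qpoch (b * x) q k.+1 = (1 - b * x) * qpoch (q ^+ s.+2 / c * x) q k.
  by rewrite qpochSl /b [q ^+ s.+2]exprS; congr (_ * qpoch _ _ _); ring.
have -> : qpoch (b * (q * x)) q k.+1
    = qpoch (q ^+ s.+2 / c * x) q k * (1 - b * x * q ^+ k.+1).
  rewrite qpochS /b [q ^+ s.+2]exprS [q ^+ k.+1]exprS.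
  by congr (qpoch _ _ _ * _); ring.
rewrite (qpochSl (q ^+ (n + s + s).+2)) (qpochSl (q ^+ s.+1)) (qpochSl (a * _)).
rewrite -(mulrA a) -!exprSr.
transitivity (qw n.+1 k.+1 * (1 - q ^+ k.+1) * (- (b * x) *
   ((1 - q ^+ (n + s + s).+2) / ((1 - q ^+ s.+1) * (1 - a * q ^+ s.+1))) *
   (qpoch (q ^+ (n + s + s).+3) q k * qpoch (q ^+ s.+2 / c * x) q k
   / (qpoch (q ^+ s.+2) q k * qpoch (a * q ^+ s.+2) q k)))).
  by rewrite !invfM; ring.
by rewrite qw_shift /b [q ^+ s.+2 in RHS]exprS; ring.
Qed.

Let connection_coef l n m := krawt l a (n - m)
   / ((q ^+ l) ^+ m * c ^+ m * qpoch q q (n - m) * qpoch q q m).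

Let connection_sum l n x := \sum_(m < n.+1) connection_coef l n m * P m x.

(** Dictated by [x = c]: the quotient of the sum in [krawt_sum_closed] by the q-Vandermonde value of
    [J n s c]. *)
Let connection_const n s := qpoch (q ^- (n + s)) q n * qpoch (a * q ^+ s.+1) q n
  / ((q ^+ (n + s)) ^+ n * (q ^+ (n + s + s).+1) ^+ n * qpoch q q n
     * qpoch (q ^- (n + s + (n + s))) q n).

Lemma connection_qdiff l n x :
  connection_sum l n.+1 x - connection_sum l n.+1 (q * x)
    = x / (q ^+ l * c) * connection_sum l n x.
Proof.
rewrite /connection_sum -sumrB big_ord_recl /= -mulrBr subrr mulr0 add0r mulr_sumr.
apply: eq_bigr => m _; rewrite /= /bump /= add1n -mulrBr Phat_qdiff /=.
rewrite /connection_coef subSS qpochS -exprS !exprS.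
have := onesubX_neq0 m; rewrite exprS => h.
field.
by rewrite h !qX_neq0 !qfact_neq0 !expf_neq0 ?c_neq0.
Qed.

(** The compatibility of the constants under the q-derivative, needed in the induction step of
    [connection]. *)
Lemma connection_coefS n s :
  connection_const n.+1 s
  * (- (q ^+ s.+2 / c) * (1 - q ^- n.+1) * (1 - q ^+ (n + s + s).+2)
    / ((1 - q ^+ s.+1) * (1 - a * q ^+ s.+1)))
  = (q ^+ (n + s.+1) * c)^-1 * connection_const n s.+1.
Proof.
rewrite /connection_const.
have -> : (n + s.+1)%N = (n.+1 + s)%N by lia.
have -> : (n.+1 + s + s.+1).+1 = (n.+1 + s + s).+2 by lia.
set l := (n.+1 + s)%N; set M := (l + s).+1.
have -> : (q ^+ M.+1) ^+ n = q ^+ n * (q ^+ M) ^+ n by rewrite exprS exprMn.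
have hl : 1 - q ^- (l + l) * q ^+ n != 0 by apply: onesubV_neq0; lia.
have hl2 : qpoch (q ^- (l + l)) q n != 0 by apply: qpochV_neq0; lia.
(* The only step that depends on the actual exponents; the rest is cancellation of nonzero
   factors. *)
have hMl : (1 - q ^- l * q ^+ n) * (1 - q ^- n.+1) * (1 - q ^+ M) * q ^+ s.+2
   = (1 - q ^+ s.+1) * (q ^+ n / q ^+ M)^-1 * (1 - q ^+ n.+1)
     * - (1 - q ^- (l + l) * q ^+ n).
  rewrite /M /l !exprS !exprD !exprS; field.
  by rewrite !qX_neq0 q_neq0.
rewrite (qpochSl (a * _)) -(mulrA a) -exprSr !(qpochS _ n) -(exprS q n).
set A := qpoch (a * _) q n; set X := qpoch (q ^- l) q n.
rewrite (exprS (q ^+ l)) (exprS (q ^+ M)).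
transitivity ((1 - q ^- l * q ^+ n) * (1 - q ^- n.+1) * (1 - q ^+ M) * q ^+ s.+2
  * - (X * (A * (1 - a * q ^+ s.+1)) / (1 - a * q ^+ s.+1) / (1 - q ^+ s.+1)
    / (q ^+ l * (q ^+ l) ^+ n * (q ^+ M * (q ^+ M) ^+ n)
       * (qpoch q q n * (1 - q ^+ n.+1))
       * (qpoch (q ^- (l + l)) q n * (1 - q ^- (l + l) * q ^+ n))) / c)).
  by rewrite !invfM; ring.
rewrite hMl; move: hl hl2 (onesubX_neq0 s) (onesubX_neq0 n) (onesub_aX_neq0 s.+1).
set D1 := 1 - q ^- (l + l) * q ^+ n; set D2 := qpoch (q ^- (l + l)) q n.
set D3 := 1 - q ^+ s.+1; set D4 := 1 - q ^+ n.+1; set D5 := 1 - a * _.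
move: D1 D2 D3 D4 D5 => D1 D2 D3 D4 D5 h1 h2 h3 h4 h5; field.
by rewrite h1 h2 h3 h4 h5 qfact_neq0 !expf_neq0 ?c_neq0.
Qed.

(** At [x = c] the numerator factor in [x] cancels a denominator factor, leaving a sum that
    [q_vandermonde] evaluates. *)
Lemma connection_at_c n s : connection_sum (n + s) n c = connection_const n s * J n s c.
Proof.
transitivity (\sum_(m < n.+1) krawt (n + s) a (n - m) * (- a) ^+ m * q ^+ 'C(m, 2)
      / ((q ^+ (n + s)) ^+ m * qpoch q q (n - m) * qpoch q q m)).
  apply: eq_bigr => m _; rewrite /connection_coef Phat_at_c /a opprK expr_div_n; field.
  by rewrite !qfact_neq0 !expf_neq0 ?c_neq0.
rewrite krawt_sum_closed ?leq_addr // bigqJacobiE.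
have ha : qpoch (a * q ^+ s.+1) q n != 0.
  by apply: qpoch_neq0 => k _; rewrite -mulrA -exprD.
under eq_bigr => k _.
  have -> : qpoch (q ^+ (n + s + s).+1) q k * qpoch (q ^+ s.+1 / c * c) q k
   / (qpoch (q ^+ s.+1) q k * qpoch (a * q ^+ s.+1) q k)
   = qpoch (q ^+ (n + s + s).+1) q k / qpoch (a * q ^+ s.+1) q k.
    rewrite divfK // invfM; move: (qpoch_qX_neq0 s k).
    by set D := qpoch (q ^+ s.+1) q k => hD; rewrite mulrA mulfK.
  over.
rewrite q_vandermonde ?qX_neq0 // /connection_const.
have -> : a * q ^+ s.+1 / q ^+ (n + s + s).+1 = a * q ^- (n + s).
  by rewrite -addSn -addnS !exprD; field; rewrite !qX_neq0.
have hl : qpoch (q ^- (n + s + (n + s))) q n != 0 by apply: qpochV_neq0; lia.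
field.
by rewrite ha hl qfact_neq0 !expf_neq0.
Qed.

Lemma connection n s : connection_sum (n + s) n =1 (fun x => connection_const n s
  * J n s x).
Proof.
elim: n s => [|n IH] s.
  move=> x; rewrite /connection_sum /connection_const bigqJacobiE !big_ord1
    /connection_coef /krawt big_ord1 !qw0 !qpoch0 !expr0 /P /=.
  by field.
apply: (polyfun_qdiff_inj _ _ c) => //.
- apply: (polyfun_sum n.+2 (fun m y => connection_coef (n.+1 + s) n.+1 m * P m y)) => m.
  by apply: polyfunM; [exact: polyfunC | exact: polyfun_Phat].
- apply: polyfunM; first exact: polyfunC.
  have [u hu] : polyfun (fun x => \sum_(k < n.+2) qw n.+1 k *
     (qpoch (q ^+ (n.+1 + s + s).+1) q k * qpoch (q ^+ s.+1 / c * x) q k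
      / (qpoch (q ^+ s.+1) q k * qpoch (a * q ^+ s.+1) q k))).
    apply: (polyfun_sum n.+2 (fun k y => qw n.+1 k *
     (qpoch (q ^+ (n.+1 + s + s).+1) q k * qpoch (q ^+ s.+1 / c * y) q k
      / (qpoch (q ^+ s.+1) q k * qpoch (a * q ^+ s.+1) q k)))) => k.
    apply: polyfunM; first exact: polyfunC.
    apply: polyfunM; last exact: polyfunC.
    apply: polyfunM; first exact: polyfunC.
    exact: polyfun_qpoch.
  by exists u => y; rewrite bigqJacobiE hu.
- move=> y; rewrite connection_qdiff -mulrBr bigqJacobi_qdiff.
  rewrite addSn -addnS IH; have := connection_coefS n s.
  set X := connection_const _ _ => e; set Y := J _ _ _.
  transitivity ((q ^+ (n + s.+1) * c)^-1 * connection_const n s.+1 * (y * Y));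
    first by ring.
  by rewrite -e; ring.
- exact: connection_at_c.
Qed.

(** At [z = 1] one term of the backward shift disappears, giving a one-step recursion. The value
    serves the case [p = 0], where [q ^+ p = 1]. *)
Lemma littleqJacobi_at1 n m :
  littleqJacobi n 1 (q ^+ m) (q ^+ m) q
  = (-1) ^+ n * q ^+ 'C((n + m).+1, 2) / q ^+ 'C(m.+1, 2).
Proof.
elim: n m => [|n IH] m.
  by rewrite littleqJacobiE big_ord1 qw0 !qpoch0 !expr0 add0n /=; field.
have := littleqJacobi_backward n m 1; rewrite subrr mul0r sub0r mul1r => e.
apply: (mulfI (onesubX_neq0 m)); rewrite -e IH.
rewrite addSnnS [in X in _ / X]binS bin1 exprD !exprS; field.
by rewrite !qX_neq0.
Qed.

(** * Coefficients of the band above the diagonal *)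

Variable l : nat.

Let alpha m := (-1) ^+ m * q ^+ 'C(m.+1, 2)
  / ((q ^+ l) ^+ m * c ^+ m * qpoch q q (l - m) * qpoch q q m).

(* The coefficient of Phat_(p+m) in the theorem, with z = q ^+ p. *)
Let upper_coef m z := if (m <= l)%N then
  alpha m * krawt l a (l - m) * littleqJacobi (l - m) z (q ^+ m) (q ^+ m) q else 0.

Lemma alphaS n m : l = (n + m).+1 ->
  alpha m * (1 - q ^+ n.+1) = - q ^+ n * c * (1 - q ^+ m.+1) * alpha m.+1.
Proof.
move=> el; rewrite /alpha; have -> : (l - m = n.+1)%N by lia.
have -> : (l - m.+1 = n)%N by lia.
have -> : q ^+ 'C(m.+2, 2) = q ^+ 'C(m.+1, 2) * q ^+ m.+1 by rewrite binS bin1 exprD.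
move: (q ^+ 'C(m.+1, 2)) => T.
rewrite !qpochS -!(exprS q) [(_ ^+ l) ^+ m.+1]exprS.
have Y0 : (q ^+ l) ^+ m != 0 by rewrite expf_neq0.
move: Y0; set Y := (q ^+ l) ^+ m; rewrite el [q ^+ (n + m).+1]exprS exprD;
  move: Y => Y Y0.
have := onesubX_neq0 n; have := onesubX_neq0 m.
set D1 := 1 - q ^+ m.+1; set D2 := 1 - q ^+ n.+1; move: D1 D2 => D1 D2 h1 h2.
rewrite [(-1) ^+ m.+1]exprS [c ^+ m.+1]exprS [q ^+ m.+1]exprS; field.
by rewrite h1 h2 Y0 !qfact_neq0 q_neq0 !expf_neq0 ?c_neq0.
Qed.

(* The (p, p + m + 1) entry of the commutation with X, with z = q ^+ p. *)
Lemma upper_commute m z :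
  upper_coef m z - upper_coef m (q * z) - z * (1 - q ^+ m.+1) * (c
    - d) * upper_coef m.+1 z
  - z / q * c * d * ((1 - z) * upper_coef m.+2 (z / q)
                      - q ^+ m.+2 * (1 - z * q ^+ m.+2) * upper_coef m.+2 z) = 0.
Proof.
have [ml|lm|ml] := ltngtP m l; rewrite /upper_coef; last first.
(* On the edge [m = l] the little q-Jacobi factor is constant, so the difference in [z] vanishes. *)
- have -> : (m.+2 <= l)%N = false by lia.
  rewrite ml leqnn subnn ltnn.
  by rewrite !littleqJacobiE !big_ord1 !expr0; ring.
- have -> : (m <= l)%N = false by lia.
  have -> : (m < l)%N = false by lia.
  have -> : (m.+1 < l)%N = false by lia.
  by ring.
have [n el] : exists n, l = (n + m).+1 by exists (l - m.+1)%N; lia.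
have hK := krawt_rec n m a; rewrite -!el in hK.
rewrite (ltnW ml) ml.
have -> : (l - m = n.+1)%N by lia.
have -> : (l - m.+1 = n)%N by lia.
have [L1 eL1] : exists L1, L1 = littleqJacobi n z (q ^+ m.+1) (q ^+ m.+1) q by eexists.
rewrite -eL1.
have hq := q_neq0; have hn := qX_neq0 n.
(* The forward shift produces exactly the left-hand side of [krawt_rec], times [L1]. *)
have first_term : alpha m * krawt l a n.+1 * littleqJacobi n.+1 z (q ^+ m) (q ^+ m) q
    - alpha m * krawt l a n.+1 * littleqJacobi n.+1 (q * z) (q ^+ m) (q ^+ m) q
  = z * alpha m.+1 * L1 * c * ((1 - q ^+ (l + m.+1)) * krawt l a n.+1).
  rewrite -mulrBr littleqJacobi_forward -eL1.
  have -> : (n + m + m).+2 = (l + m.+1)%N by lia.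
  have hm := onesubX_neq0 m.
  transitivity (- (alpha m * (1 - q ^+ n.+1)) * krawt l a n.+1 / q ^+ n
     * z * (1 - q ^+ (l + m.+1)) / (1 - q ^+ m.+1) * L1).
    by rewrite !exprS; rewrite exprS in hm; field; rewrite hm hn hq.
  by rewrite (alphaS n) //; field; rewrite hm.
rewrite first_term hK.
(* For [n = 0] the coefficient at [m.+2] lies outside the band, and the last term of [krawt_rec]
   vanishes as well. *)
case: n el eL1 hK hn first_term => [|n] el eL1 hK hn _.
  have -> : (m.+1 < l)%N = false by lia.
  by rewrite expr0 /a; field; rewrite ?c_neq0 ?hq.
have -> : (m.+1 < l)%N by lia.
have -> : (l - m.+2 = n)%N by lia.
have := littleqJacobi_backward n m.+1 z; rewrite -eL1.
set L2 := littleqJacobi _ _ _ _ _; set L3 := littleqJacobi _ _ _ _ _ => eL.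
have ea := alphaS n m.+1 (etrans el (congr1 S (addSnnS n m))).
transitivity (z * alpha m.+1 * L1 * c * ((1 - q ^+ m.+1) * (1 + a) * krawt l a n.+1
     + a * (q ^- n.+1 - 1) * krawt l a n)
   - z * (1 - q ^+ m.+1) * (c - d) * (alpha m.+1 * krawt l a n.+1 * L1)
   - z / q * c * d * alpha m.+2 * krawt l a n * ((1 - z) * L2 - q ^+ m.+2 * (1
     - z * q ^+ m.+2) * L3)).
  by rewrite /=; ring.
(* The backward shift returns a multiple of [L1], so [L1] is common to all terms. The
   [krawt l a n.+1] terms cancel because [c * (1 + a) = c - d]; the others cancel by [alphaS]. *)
rewrite eL.
transitivity (z * L1 * d * krawt l a n * (- (alpha m.+1 * (q ^- n.+1 - 1))
    - c * (1 - q ^+ m.+2) * alpha m.+2 / q)).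
  by rewrite /a; field; rewrite hq hn c_neq0.
have -> : alpha m.+1 * (q ^- n.+1 - 1) = alpha m.+1 * (1 - q ^+ n.+1) / q ^+ n.+1.
  by field.
by rewrite ea !exprS; field; rewrite qX_neq0 hq.
Qed.

(** * The commuting band matrix *)

(** [beta] and [gamma] are the diagonal and lower coefficients of the recurrence; [gamma_prod n] is
    the squared norm of [P n] relative to that of [P 0]. *)
Let beta n := q ^+ n * (c - d).
Let gamma n := q ^+ n / q * c * d * (1 - q ^+ n).
Let gamma_prod n := \prod_(i < n) gamma i.+1.

Lemma gamma0 : gamma 0 = 0.
Proof. by rewrite /gamma expr0 subrr mulr0. Qed.

Lemma gammaS_neq0 n : gamma n.+1 != 0.
Proof. by rewrite !mulf_neq0 ?invr_eq0 ?onesubX_neq0 // gt_eqF. Qed.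

Lemma gamma_prodS n : gamma_prod n.+1 = gamma_prod n * gamma n.+1.
Proof. by rewrite /gamma_prod big_ord_recr. Qed.

Lemma gamma_prod_neq0 n : gamma_prod n != 0.
Proof. by apply/prodf_neq0 => i _; apply: gammaS_neq0. Qed.

(* band p r / gamma_prod r is the coefficient of Phat_r in the expansion at p;
   the factor gamma_prod makes the matrix symmetric. *)
Let band p r := upper_coef (maxn p r - minn p r) (q ^+ minn p r) * gamma_prod (maxn p r).

Lemma bandC p r : band p r = band r p.
Proof. by rewrite /band maxnC minnC. Qed.

Lemma band_le p m : band p (p + m) = upper_coef m (q ^+ p) * gamma_prod (p + m).
Proof.
rewrite /band (maxn_idPr (leq_addr m p)) (minn_idPl (leq_addr m p)).
by have -> : (p + m - p = m)%N by lia.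
Qed.

Lemma band_far p r : (p + l < r)%N -> band p r = 0.
Proof.
move=> hr; have -> : r = (p + (r - p))%N by lia.
by rewrite band_le /upper_coef ifN ?mul0r // -ltnNge; lia.
Qed.

(** By symmetry of [band] one may take [p <= r]. On the diagonal symmetry alone suffices; above it
    the identity is [upper_commute] times [gamma_prod]. *)
Lemma band_commute p r :
  gamma r * band p r.-1 + beta r * band p r + band p r.+1
  = band p.+1 r + beta p * band p r + gamma p * band p.-1 r.
Proof.
wlog pr : p r / (p <= r)%N => [hw|].
  have [/hw //|/ltnW /hw e] := leqP p r.
  rewrite (bandC p r.-1) (bandC p r) (bandC p r.+1) (bandC p.+1 r) (bandC p.-1 r).
  by rewrite addrC addrA [in LHS]addrAC -e; ring.
have [m ->] : exists m, r = (p + m)%N by exists (r - p)%N; lia.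
case: m => [|m]; first by rewrite addn0 (bandC p.+1) (bandC p.-1); ring.
have e1 : band p (p + m.+1).-1 = upper_coef m (q ^+ p) * gamma_prod (p + m)
  by rewrite addnS band_le.
have e2 : band p (p + m.+1).+1 = upper_coef m.+2 (q ^+ p) * (gamma_prod (p
  + m.+1) * gamma (p + m.+2)).
  by rewrite -addnS band_le (addnS p m.+1) gamma_prodS.
have e3 : band p.+1 (p + m.+1) = upper_coef m (q * q ^+ p) * gamma_prod (p + m.+1).
  by rewrite addnS -addSn band_le exprS.
(* At [p = 0] the argument [q ^+ p / q] matches no row of the matrix, but [gamma 0 = 0]. *)
have e4 : gamma p * band p.-1 (p + m.+1)
    = gamma p * (upper_coef m.+2 (q ^+ p / q) * gamma_prod (p + m.+1)).
  case: (p) => [|p']; first by rewrite gamma0 !mul0r.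
  have -> : q ^+ p'.+1 / q = q ^+ p' by rewrite exprS; field.
  by rewrite /= addSnnS band_le.
have e5 : gamma_prod (p + m.+1) = gamma_prod (p + m) * gamma (p + m.+1)
  by rewrite addnS gamma_prodS.
rewrite e1 e2 e3 e4 band_le.
apply/eqP; rewrite -subr_eq0; apply/eqP.
rewrite -[RHS](mulr0 (gamma_prod (p + m.+1))) -[in RHS](upper_commute m (q ^+ p)).
transitivity ((gamma (p + m.+1) * gamma_prod (p + m)) * upper_coef m (q ^+ p)
  + gamma_prod (p + m.+1) *
  (- upper_coef m (q * q ^+ p) + (beta (p + m.+1) - beta p) * upper_coef m.+1 (q ^+ p)
   + gamma (p + m.+2) * upper_coef m.+2 (q ^+ p)
     - gamma p * upper_coef m.+2 (q ^+ p / q))).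
  by ring.
rewrite [gamma _ * gamma_prod _]mulrC -e5 /beta /gamma !exprD; ring.
Qed.

(** With this scaling, multiplication by [x] acts through the transpose of the recurrence matrix, as
    needed to move it onto the column index of [band]. *)
Let scaled_Phat r x := P r x / gamma_prod r.

Lemma scaled_Phat_rec x r : x * scaled_Phat r x
  = gamma r.+1 * scaled_Phat r.+1 x + beta r * scaled_Phat r x
    + (if r is r'.+1 then scaled_Phat r' x else 0).
Proof.
have -> : (if r is r'.+1 then scaled_Phat r' x else 0)
  = gamma r * P r.-1 x / gamma_prod r.
  case: (r) => [|r'] /=; first by rewrite gamma0 !mul0r.
  by rewrite /scaled_Phat gamma_prodS; field; rewrite gamma_prod_neq0 gammaS_neq0.
rewrite /scaled_Phat gamma_prodS PhatS -/(beta r) -/(gamma r); field.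
by rewrite gamma_prod_neq0 gammaS_neq0.
Qed.

Let band_sum K p x := \sum_(r < K) band p r * scaled_Phat r x.

(** Multiplication by [x] is moved to the column index, then to the row index by [band_commute]. The
    bound on [K] makes column [K.-1] of row [p] zero, so truncation leaves no boundary term. *)
Lemma band_sum_rec K p x : ((p + l).+1 < K)%N ->
  x * band_sum K p x = band_sum K p.+1 x + beta p * band_sum K p x
    + gamma p * band_sum K p.-1 x.
Proof.
move=> hK; case: K hK => // K hK.
transitivity (\sum_(r < K.+1) (band p.+1 r + beta p * band p r
  + gamma p * band p.-1 r) * scaled_Phat r x);
  last first.
  rewrite /band_sum !mulr_sumr -!big_split /=; apply: eq_bigr => r _; ring.
under [RHS]eq_bigr => r _ do rewrite -band_commute.
transitivity (\sum_(r < K.+1) (band p r * (gamma r.+1 * scaled_Phat r.+1 x)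
    + band p r * (beta r * scaled_Phat r x) + band p r
      * (if r : nat is r'.+1 then scaled_Phat r' x else 0))).
  rewrite /band_sum mulr_sumr; apply: eq_bigr => r _.
  by rewrite -!mulrDr -scaled_Phat_rec; ring.
rewrite !big_split /=.
under [RHS]eq_bigr => r _ do rewrite !mulrDl.
rewrite !big_split /=; congr (_ + _ + _).
- rewrite big_ord_recr [RHS]big_ord_recl /= gamma0 !mul0r add0r band_far ?mul0r ?addr0.
    by apply: eq_bigr => r _; rewrite /bump /=; ring.
  by lia.
- by apply: eq_bigr => r _; ring.
- rewrite big_ord_recl [RHS]big_ord_recr /= mulr0 add0r (band_far p K.+1) ?mul0r
    ?addr0 //.
  by lia.
Qed.

(** Both sides satisfy the same three-term recurrence in [p] and agree at [p = 0]. *)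
Lemma band_sum_mul K p x : (p + l < K)%N -> band_sum K p x = P p x * band_sum K 0 x.
Proof.
have [] : ((p + l < K)%N -> band_sum K p x = P p x * band_sum K 0 x) /\
  ((p.+1 + l < K)%N -> band_sum K p.+1 x = P p.+1 x * band_sum K 0 x); last by [].
elim: p => [|p [IH1 IH2]].
  split=> [_|hK]; first by rewrite /P /= mul1r.
  have := band_sum_rec K 0 x hK; rewrite gamma0 mul0r addr0 => e.
  rewrite PhatS expr0 subrr mulr0 mul0r subr0 /P /= mulr1.
  by rewrite mulrBl e /beta expr0; ring.
split=> // hK; have := band_sum_rec K p.+1 x hK; rewrite /= => e.
rewrite PhatS -/(beta p.+1) -/(gamma p.+1) /= !mulrBl -(mulrA _ (P p x)) -IH1; last
  by lia.
rewrite -!mulrA -IH2; last by lia.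
by rewrite e /beta /gamma; ring.
Qed.

(** * Matching the normalisation of the theorem *)

Lemma gamma_prodE n : gamma_prod n = (c * d) ^+ n * q ^+ 'C(n, 2) * qpoch q q n.
Proof.
elim: n => [|n IH]; first by rewrite /gamma_prod big_ord0 qpoch0 !expr0 !mulr1.
rewrite gamma_prodS IH binS bin1 exprD qpochS exprS /gamma -!(exprS q)
  [q ^+ n.+1 / q]mulrC.
by rewrite exprS; field.
Qed.

Lemma bin2_add r m : ('C(r + m, 2) + 'C(m.+1, 2) = 'C(r, 2) + m * (r + m))%N.
Proof.
elim: m => [|m IH]; first by rewrite addn0 mul0n.
by rewrite addnS binS bin1 (binS m.+1) bin1; lia.
Qed.

Lemma expfzB m n : q ^ (m%:Z - n%:Z) = q ^+ m / q ^+ n.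
Proof. by rewrite expfzDr // -invr_expz. Qed.

Lemma qpoch_downE r m : qpoch_down q (r + m) m = qpoch q q (r + m) / qpoch q q r.
Proof.
rewrite qpoch_add mulrAC divff ?qfact_neq0 // mul1r -exprS.
rewrite /qpoch /qpoch_down (reindex_inj rev_ord_inj) /=; apply: eq_bigr => j _.
rewrite subzn; last by lia.
by rewrite -exprD; congr (1 - _ ^+ _); have := ltn_ord j; lia.
Qed.

Lemma triangularE n : ((n * n.+1)./2 = 'C(n.+1, 2))%N.
Proof. by rewrite bin2 mulnC. Qed.

Lemma dualqKrawtchoukE j : dualqKrawtchouk j l (c / d) (2 * l)%N q = krawt l a j.
Proof.
apply: eq_bigr => k _; rewrite /qw mul2n -addnn.
have -> : - (c / d)^-1 * q ^ (l%:Z - (l + l)%:Z) = a * q ^- l.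
  by rewrite expfzB exprD /a invf_div; field; rewrite qX_neq0 c_neq0.
by rewrite !invfM; ring.
Qed.

(** In row 0 the little q-Jacobi values are those at 1; by [littleqJacobi_at1] they cancel the sign
    and the power of [q] in [alpha m] that depend on [m]. *)
Lemma band_sum0 p x : band_sum (p + l).+1 0 x
  = (-1) ^+ l * q ^+ 'C(l.+1, 2) * connection_sum l l x.
Proof.
rewrite /band_sum addnC -addSn big_split_ord /= [X in _ + X]big1 ?addr0; last first.
  by move=> i _; rewrite band_far ?mul0r //; lia.
rewrite /connection_sum mulr_sumr; apply: eq_bigr => m _.
have ml : (m <= l)%N by have := ltn_ord m; lia.
rewrite -[in band 0 m](add0n m) band_le add0n /scaled_Phat /upper_coef ml expr0
  littleqJacobi_at1 subnK //.
rewrite /alpha /connection_coef.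
have e : (-1) ^+ l = (-1) ^+ m * (-1) ^+ (l - m) :> C by rewrite -exprD subnKC.
rewrite e; field.
by rewrite gamma_prod_neq0 !qfact_neq0 !qX_neq0 !expf_neq0 ?c_neq0.
Qed.

(** Obtained by comparing the closed forms of [qw l l] and [qw (l + l) l]. *)
Lemma qpochV_diag : qpoch (q ^- l) q l * qpoch (q ^+ l.+1) q l
  = (q ^+ l) ^+ l * qpoch q q l * qpoch (q ^- (l + l)) q l.
Proof.
have := qw_closed 0 l; have := qw_closed l l.
have eY : (q ^+ (l + l)) ^+ l = (q ^+ l) ^+ l * (q ^+ l) ^+ l by rewrite exprD exprMn.
rewrite /qw qpoch0 add0n (qpoch_add q l l) -exprS eY.
have hq := qfact_neq0 l; have hl := qX_neq0 l.
have hY : (q ^+ l) ^+ l != 0 by rewrite expf_neq0.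
move=> e1 e2.
have -> : qpoch (q ^- l) q l = (qpoch (q ^- l) q l / qpoch q q l * q ^+ l)
  * qpoch q q l / q ^+ l.
  by field; rewrite hq hl.
have -> : qpoch (q ^- (l + l)) q l
   = (qpoch (q ^- (l + l)) q l / qpoch q q l * q ^+ l) * qpoch q q l / q ^+ l.
  by field; rewrite hq hl.
rewrite e2 e1; move: hY; set Y := (q ^+ l) ^+ l; move: Y => Y hY.
by field; rewrite hq hl hY.
Qed.

Lemma big_q_side p x :
  (-1) ^+ l * q ^- ((l * l.+1)./2)%N * qpoch (- q * d / c) q l
    / qpoch (q ^+ l.+1) q l * bigqJacobi l x 1 1 c d q
  = band_sum (p + l).+1 0 x.
Proof.
rewrite band_sum0 triangularE.
have := connection l 0 x; rewrite addn0 /J expr0 => ->.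
have -> : - q * d / c = a * q by rewrite /a; ring.
rewrite /connection_const !addn0 expr1 mulrA; congr (_ * _).
have h1 : qpoch (q ^- (l + l)) q l != 0 by apply: qpochV_neq0; lia.
have h2 := qpoch_qX_neq0 l l.
have h3 : (q ^+ l) ^+ l * qpoch q q l * qpoch (q ^- (l + l)) q l != 0.
  by rewrite !mulf_neq0 ?qfact_neq0 ?expf_neq0.
(* This accounts for the opposite signs of the exponent ['C(l.+1, 2)] on the two sides. *)
have e : (q ^+ l.+1) ^+ l = q ^+ 'C(l.+1, 2) * q ^+ 'C(l.+1, 2).
  rewrite -exprM -exprD; congr (_ ^+ _).
  by have := bin2_add 1 l; rewrite add1n /= => ->; rewrite mulnC bin_small.
transitivity ((-1) ^+ l * q ^+ 'C(l.+1, 2) * qpoch (a * q) q l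
    / ((q ^+ l.+1) ^+ l * qpoch (q ^+ l.+1) q l)
    * ((qpoch (q ^- l) q l * qpoch (q ^+ l.+1) q l)
        / ((q ^+ l) ^+ l * qpoch q q l * qpoch (q ^- (l + l)) q l))).
  rewrite qpochV_diag divff // e; move: h2; set D := qpoch (q ^+ l.+1) q l.
  by move: D => D h2; field; rewrite h2 qX_neq0.
have hY : (q ^+ l) ^+ l != 0 by rewrite expf_neq0.
have hZ : (q ^+ l.+1) ^+ l != 0 by rewrite expf_neq0.
move: h1 h2 hY hZ; set D1 := qpoch _ _ _; set D2 := qpoch (q ^+ l.+1) q l.
set Y := (q ^+ l) ^+ l; set Z := (q ^+ l.+1) ^+ l; move: D1 D2 Y Z => D1 D2 Y Z.
by move=> h1 h2 hY hZ; field; rewrite h1 h2 hY hZ qfact_neq0.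
Qed.

(** Below the diagonal the theorem's coefficients are the transposed upper ones, rescaled by a
    quotient of norms; here [p = r + m]. *)
Lemma down_coef r m : (m <= l)%N ->
  (-1) ^+ m * d ^+ m * q ^ (m%:Z * ((r + m)%N%:Z - l%:Z)) * qpoch_down q (r + m) m
    / (qpoch q q (l - m)%N * qpoch q q m)
  = alpha m * (gamma_prod (r + m) / gamma_prod r).
Proof.
move=> ml; rewrite mulrBr -!PoszM expfzB qpoch_downE !gamma_prodE /alpha.
have e : q ^+ 'C(r + m, 2) * q ^+ 'C(m.+1, 2) = q ^+ 'C(r, 2) * q ^+ (m * (r + m)).
  by rewrite -!exprD bin2_add.
transitivity ((-1) ^+ m * (q ^+ 'C(r + m, 2) * q ^+ 'C(m.+1, 2)) * (c * d) ^+ (r + m)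
    / (c * d) ^+ r / c ^+ m / q ^+ 'C(r, 2) / (q ^+ l) ^+ m
    * (qpoch q q (r + m) / qpoch q q r)
    / (qpoch q q (l - m)%N * qpoch q q m)).
  have hcd : (c * d) ^+ r != 0 by rewrite expf_neq0 // mulf_neq0 // gt_eqF.
  rewrite e (mulnC m l) [q ^+ (l * m)]exprM
    [(c * d) ^+ (r + m)]exprD [(c * d) ^+ m]exprMn.
  have hY : (q ^+ l) ^+ m != 0 by rewrite expf_neq0.
  move: hcd hY; set X := (c * d) ^+ r; set Y := (q ^+ l) ^+ m; move: X Y => X Y hX hY.
  field.
  by rewrite hX hY !qfact_neq0 !qX_neq0 expf_neq0 ?c_neq0.
by rewrite !invfM; ring.
Qed.

Lemma big_q_Legendre_mul_Phat (p : nat) x :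
  let R := fun j : nat => dualqKrawtchouk j l (c / d) (2 * l)%N q in
  (-1) ^+ l * q ^- ((l * l.+1)./2)%N * qpoch (- q * d / c) q l
    / qpoch (q ^+ l.+1) q l
    * bigqJacobi l x 1 1 c d q * Phat p x c d q
  = (qpoch q q l)^-1 * R l * littleqJacobi l (q ^+ p) 1 1 q * Phat p x c d q
    + \sum_(1 <= m < l.+1)
        (-1) ^+ m * d ^+ m * q ^ (m%:Z * (p%:Z - l%:Z)) * qpoch_down q p m
          / (qpoch q q (l - m)%N * qpoch q q m)
          * R (l - m)%N * littleqJacobi (l - m)%N (q ^ (p%:Z - m%:Z)) (q ^+ m) (q ^+ m) q
          * Phat (p%:Z - m%:Z) x c d q
    + \sum_(1 <= m < l.+1)
        (-1) ^+ m * q ^ (((m * m.+1)./2)%N%:Z - (l * m)%N%:Z)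
          / (c ^+ m * qpoch q q (l - m)%N * qpoch q q m)
          * R (l - m)%N * littleqJacobi (l - m)%N (q ^+ p) (q ^+ m) (q ^+ m) q
          * Phat (p%:Z + m%:Z) x c d q.
Proof.
rewrite /= (big_q_side p) mulrC -band_sum_mul // dualqKrawtchoukE.
(* The row is cut at column [p]: the diagonal entry gives the first term, the columns before and
   after it the two sums. *)
rewrite /band_sum -addnS big_split_ord /= [X in _ + X
  = _]big_ord_recl addrA [X in X + _ = _]addrC.
congr (_ + _ + _).
- rewrite band_le /scaled_Phat /upper_coef leq0n subn0 addn0 /alpha subn0 !expr0 qpoch0.
  by field; rewrite gamma_prod_neq0 qfact_neq0.
- pose D m := alpha m * (gamma_prod p / gamma_prod (p - m)) * krawt l a (l - m)
    * littleqJacobi (l - m) (q ^+ (p - m)) (q ^+ m) (q ^+ m) q * P (p - m) x.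
  transitivity (\sum_(1 <= m < p.+1) if (m <= l)%N then D m else 0).
    rewrite big_add1 /= big_mkord (reindex_inj rev_ord_inj) /=; apply: eq_bigr => m _.
    have mp := ltn_ord m.
    have e : p = (p - m.+1 + m.+1)%N by lia.
    have -> : band p (p - m.+1) = upper_coef m.+1 (q ^+ (p - m.+1)) * gamma_prod p.
      by rewrite bandC [in X in band _ X]e band_le -e.
    rewrite /scaled_Phat /upper_coef; case: ifP => _; last by rewrite !mul0r.
    by rewrite /D; ring.
  (* Both forms sum [D m] over the positive [m] bounded by both [p] and [l]. *)
  transitivity (\sum_(1 <= m < l.+1) if (m <= p)%N then D m else 0).
    rewrite (big_nat_widen _ _ (maxn l p).+1) ?ltnS ?leq_maxr //.
    rewrite [RHS](big_nat_widen _ _ (maxn l p).+1) ?ltnS ?leq_maxl //.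
    rewrite big_mkcond [RHS]big_mkcond /=; apply: eq_bigr => m _; rewrite !ltnS.
    by case: (m <= l)%N; case: (m <= p)%N.
  apply: eq_big_nat => m /andP[_]; rewrite ltnS dualqKrawtchoukE => ml;
    case: leqP => [mp|pm].
    have [r ep] : exists r, p = (r + m)%N by exists (p - m)%N; lia.
    by rewrite /D (subzn mp) ep addnK down_coef.
  (* For [m > p] the index is negative and [Phat] is zero by definition. *)
  have -> : p%:Z - m%:Z = Negz (m - p).-1 by lia.
  by rewrite /= mulr0.
- rewrite big_add1 -pred_Sn big_mkord; apply: eq_bigr => m _; have ml := ltn_ord m.
  rewrite dualqKrawtchoukE triangularE expfzB exprM /= /bump /= add1n band_le
    /scaled_Phat /upper_coef ml /alpha.
  have hY : (q ^+ l) ^+ m.+1 != 0 by rewrite expf_neq0.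
  move: hY; set Y := (q ^+ l) ^+ m.+1; move: Y => Y hY.
  by field; rewrite hY gamma_prod_neq0 !qfact_neq0 expf_neq0 ?c_neq0.
Qed.

End QSeries.

Theorem theorem4p3 (C : numClosedFieldType) (q c d x : C) (p l : nat) :
  0 < q -> q < 1 -> 0 < c -> 0 < d ->
  let R := fun j : nat => dualqKrawtchouk j l (c / d) (2 * l)%N q in
  (-1) ^+ l * q ^- ((l * l.+1)./2)%N * qpoch (- q * d / c) q l
    / qpoch (q ^+ l.+1) q l
    * bigqJacobi l x 1 1 c d q * Phat p x c d q
  = (qpoch q q l)^-1 * R l * littleqJacobi l (q ^+ p) 1 1 q * Phat p x c d q
    + \sum_(1 <= m < l.+1)
        (-1) ^+ m * d ^+ m * q ^ (m%:Z * (p%:Z - l%:Z)) * qpoch_down q p m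
          / (qpoch q q (l - m)%N * qpoch q q m)
          * R (l - m)%N * littleqJacobi (l - m)%N (q ^ (p%:Z - m%:Z)) (q ^+ m) (q ^+ m) q
          * Phat (p%:Z - m%:Z) x c d q
    + \sum_(1 <= m < l.+1)
        (-1) ^+ m * q ^ (((m * m.+1)./2)%N%:Z - (l * m)%N%:Z)
          / (c ^+ m * qpoch q q (l - m)%N * qpoch q q m)
          * R (l - m)%N * littleqJacobi (l - m)%N (q ^+ p) (q ^+ m) (q ^+ m) q
          * Phat (p%:Z + m%:Z) x c d q.
Proof.
by move=> q0 q1 c0 d0; apply: big_q_Legendre_mul_Phat.
Qed.
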